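(* Let $A=(a_n)_{n\in\mathbb{N}}$ and $B=(b_n)_{n\in\mathbb{N}}$ be two Waterman sequences, i.e., nonincreasing sequences of positive real numbers with $\sum_{n=1}^\infty a_n=\infty$ and $\sum_{n=1}^\infty b_n=\infty$. The following statements are equivalent: (a) $\sum_{i=1}^n b_i=O\left(\sum_{i=1}^n a_i\right)$, i.e., there is $\eta>0$ such that $\frac{\sum_{i=1}^n b_i}{\sum_{i=1}^n a_i}\le\eta$ for all $n\in\mathbb{N}$; (b) $\mathcal{I}_A\le_K\mathcal{I}_B$; (c) $\phi_B\preceq_m\phi_A$; (d) $ABV\subseteq BBV$; (e) $\mathrm{mEXH}(\phi_A)\subseteq\mathrm{mEXH}(\phi_B)$; (f) $\mathrm{mFIN}(\phi_A)\subseteq\mathrm{mFIN}(\phi_B)$; (g) $\mathrm{mEXH}(\phi_A)\subseteq\mathrm{mFIN}(\phi_B)$.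
   Context: $\mathbb{N}=\{1,2,3,\ldots\}$. For a Waterman sequence $A=(a_n)$: $\mathcal{I}_A=\{C\subseteq\mathbb{N}:\sum_{n\in C}a_n<\infty\}$ is the summable ideal, and $\phi_A(C)=\sum_{n\in C}a_n$ for $C\subseteq\mathbb{N}$. Katětov order: for ideals $\mathcal{I},\mathcal{J}$ on $\mathbb{N}$, $\mathcal{I}\le_K\mathcal{J}$ means that there is a function $f:\mathbb{N}\to\mathbb{N}$ such that $f^{-1}[C]\in\mathcal{J}$ for every $C\in\mathcal{I}$. For $x\in\mathbb{R}^{\mathbb{N}}$, $\hat\phi_A(x)=\sup\{\sum_n\mu(\{n\})|x_n|:\mu\text{ a measure on }\mathbb{N},\ \mu\le\phi_A\}=\sum_{n\in\mathbb{N}}a_n|x_n|\in[0,\infty]$; for a finite sequence $x$, $\hat\phi_A(x)$ means $\hat\phi_A$ of $x$ extended by zeros. Let $\mathrm{Mon}=\{x\in\mathbb{R}^{\mathbb{N}}:|x_{n+1}|\le|x_n|\text{ for all }n\in\mathbb{N}\}$, $\mathrm{mFIN}(\phi_A)=\{x\in\mathrm{Mon}:\hat\phi_A(x)<\infty\}$, $\mathrm{mEXH}(\phi_A)=\{x\in\mathrm{Mon}:\lim_{n\to\infty}\hat\phi_A(x\cdot\chi_{\{n,n+1,\ldots\}})=0\}$. $\phi_B\preceq_m\phi_A$ means: there is $M>0$ such that $\hat\phi_B(x)\le M\hat\phi_A(x)$ for every finite real sequence $x=(x_1,\ldots,x_n)$, $n\in\mathbb{N}$, with $|x_1|\ge|x_2|\ge\cdots\ge|x_n|$.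 Let $I=[0,1]$. $ABV$ is the set of all functions $x:I\to\mathbb{R}$ of bounded $A$-variation, i.e., for which there is $M>0$ such that $\sum_{n=1}^\infty a_n|x(t_n)-x(s_n)|\le M$ for every sequence $([s_n,t_n])_{n\in\mathbb{N}}$ of nonoverlapping (pairwise disjoint interiors) closed, possibly degenerate, subintervals of $I$. $BBV$ is defined in the same way with $B=(b_n)$ in place of $A$. *)

(* Defs.v *)
From HB Require Import structures.
From mathcomp Require Import all_boot all_order all_algebra.
From mathcomp Require Import all_classical all_reals all_analysis.

Set Implicit Arguments.
Unset Strict Implicit.
Unset Printing Implicit Defensive.
Import Order.TTheory GRing.Theory Num.Theory numFieldNormedType.Exports.

Local Open Scope classical_set_scope.
Local Open Scope ring_scope.

(* Sequences are indexed from 0: the value at n : nat stands for the term of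
   rank n + 1, and subsets of {1, 2, ...} are shifted accordingly. *)

Definition Waterman (R : realType) (a : nat -> R) : Prop :=
  [/\ forall n, 0 < a n,
      forall n, a n.+1 <= a n
    & (\sum_(0 <= n <oo) (a n)%:E)%E = +oo%E].

Definition phi (R : realType) (a : nat -> R) (C : set nat) : \bar R :=
  (\esum_(n in C) (a n)%:E)%E.

Definition summable_ideal (R : realType) (a : nat -> R) : set (set nat) :=
  [set C | (phi a C < +oo)%E].

Definition Katetov_le (I J : set (set nat)) : Prop :=
  exists f : nat -> nat, forall C, I C -> J (f @^-1` C).

(* The sigma-algebra carried by the type nat is the power set, so a measure on
   nat is defined on every set of naturals. *)
Definition hphi (R : realType) (a : nat -> R) (x : nat -> R) : \bar R :=
  ereal_sup [set s | exists2 mu : {measure set nat -> \bar R},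
    (forall C, mu C <= phi a C)%E
    & s = (\sum_(0 <= n <oo) mu [set n] * `|x n|%:E)%E].

Lemma hphiE (R : realType) (a : nat -> R) (x : nat -> R) :
  (forall n, 0 <= a n) -> hphi a x = (\sum_(0 <= n <oo) (a n * `|x n|)%:E)%E.
Proof.
move=> a0.
have phi1 n : phi a [set n] = (a n)%:E by rewrite /phi esum_set1 ?lee_fin.
apply/eqP; rewrite eq_le; apply/andP; split.
  apply: ge_ereal_sup => _ [mu mu_le ->].
  apply: lee_nneseries => [n _|n _]; first by rewrite mule_ge0 ?lee_fin.
  by rewrite EFinM lee_wpmul2r ?lee_fin// -phi1.
have phi0 : phi a set0 = 0%E by rewrite /phi esum_set0.
have phi_ge0 C : (0 <= phi a C)%E.
  by apply: esum_ge0 => n _; rewrite lee_fin.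
have phi_sigma : semi_sigma_additive (phi a).
  move=> F mF tF mUF; rewrite /phi.
  rewrite (_ : (\esum_(n in _) _)%E = (\esum_(k in setT) phi a (F k))%E).
    rewrite -nneseries_esumT => [|n]; last exact: phi_ge0.
    by apply: is_cvg_nneseries => n _ _; exact: phi_ge0.
  by apply: esum_bigcupT => // n; rewrite lee_fin.
pose mphi := isMeasure.Build _ _ _ (phi a) phi0 phi_ge0 phi_sigma.
pose mu : {measure set nat -> \bar R} := HB.pack (phi a) mphi.
apply: ereal_sup_ubound; exists mu; first by [].
by apply: eq_eseriesr => n _; rewrite EFinM /= phi1.
Qed.

Definition Mon (R : realType) : set (nat -> R) :=
  [set x | forall n, `|x n.+1| <= `|x n|].

Definition mFIN (R : realType) (a : nat -> R) : set (nat -> R) :=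
  [set x | Mon x /\ (hphi a x < +oo)%E].

Definition mEXH (R : realType) (a : nat -> R) : set (nat -> R) :=
  [set x | Mon x /\
    hphi a (x \* \1_[set k : nat | (n <= k)%N]) @[n --> \oo] --> 0%E].

(* nth 0 x is the finite sequence x extended by zeros. *)
Definition mono_dominated (R : realType) (b a : nat -> R) : Prop :=
  exists2 M : R, 0 < M &
    forall (n : nat) (x : n.+1.-tuple R),
      (forall i j : 'I_n.+1, (i <= j)%N -> `|tnth x j| <= `|tnth x i|) ->
      (hphi b (nth 0%R x) <= M%:E * hphi a (nth 0%R x))%E.

Definition unit_itv (R : realType) : set R := [set` `[0, 1]].
Arguments unit_itv R : clear implicits.

(* The members of BV a are functions defined on [0, 1] only. *)
Definition BV (R : realType) (a : nat -> R) : set (unit_itv R -> R) :=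
  [set x | exists2 M : R, 0 < M &
    forall s t : nat -> unit_itv R,
      (forall n, set_val (s n) <= set_val (t n)) ->
      trivIset setT
        (fun n => [set` `[set_val (s n), set_val (t n)]]°) ->
      (\sum_(0 <= n <oo) (a n * `|x (t n) - x (s n)|)%:E <= M%:E)%E].

(* Main.v *)
Require Import Defs.
From mathcomp Require Import all_boot all_order all_algebra.
From mathcomp Require Import all_classical all_reals all_analysis.
From mathcomp Require Import ring lra zify.
Import Order.TTheory GRing.Theory Num.Theory numFieldNormedType.Exports.

(** Write [A n] and [B n] for the sums of the first [n] terms of [a] and [b]. The
    hub of the proof is the inequality [B n <= eta * A n] for all [n], and the
    conditions are compared with it, or with one another, as follows.

    Partial sums and monotone sequences: by summation by parts
    ([ler_sum_abel]), an inequality between partial sums is the same as an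
    inequality between the sums weighted by any nonincreasing nonnegative
    sequence, which is the domination on monotone sequences
    ([mono_dominated_of_sum_le]).

    Katetov order: [Katetov_of_sum_le] lays the numbers [b k] end to end on the
    half-line, as well as the numbers [2 * eta * a n], and maps [k] to the [n]
    whose interval contains the left end of the interval of [k]; the fiber over
    [n] has [b]-mass at most [4 * eta * a n]. Conversely, [sum_le_of_Katetov]
    shows by a gliding hump that the preimages under a Katetov map have
    [b]-mass at most linear in the [a]-mass, up to a constant; since the first
    [k] indices have at most [k] images, [B k] is controlled by [A k].

    Bounded variation: a finite family of intervals may be enumerated by
    decreasing oscillation, which reduces the inclusion of the function spaces
    to monotone sequences ([mono_dominated_BV]). Conversely a monotone sequence
    is the sequence of heights of the spikes of a function whose variation is,
    up to a factor 2, the norm of the sequence ([mFIN_of_BV]).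

    Sequence spaces: [mEXH] and [mFIN] coincide for the weights at hand
    ([mEXH_mFIN]), so the three inclusions are the same. If no [eta] exists,
    condensing indicators of initial segments on which [B n / A n] is huge
    yields a monotone sequence in the first space and not in the second
    ([sum_le_of_mFIN]). *)

Set Implicit Arguments.
Unset Strict Implicit.
Unset Printing Implicit Defensive.

Local Open Scope classical_set_scope.
Local Open Scope ring_scope.

(** * Comparison of finite sums *)

Lemma ler_sum_nat_mono (R : realType) (a : nat -> R) (m n : nat) :
  (forall n, 0 <= a n) -> (m <= n)%N -> \sum_(i < m) a i <= \sum_(i < n) a i.
Proof.
move=> a0 mn; rewrite -!(big_mkord predT) [leRHS](big_cat_nat (n := m))//= lerDl.
exact: sumr_ge0.
Qed.

Lemma ler_sum_subpred (R : realType) (n : nat) (P Q : pred 'I_n) (u : 'I_n -> R) :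
  (forall i, 0 <= u i) -> (forall i, P i -> Q i) ->
  \sum_(i | P i) u i <= \sum_(i | Q i) u i.
Proof.
move=> u0 PQ; rewrite [leLHS]big_mkcond [leRHS]big_mkcond.
by apply: ler_sum => i _; case: ifPn => [/PQ->//|_]; case: ifP.
Qed.

Lemma sum_half_le (R : realType) (N : nat) :
  \sum_(j < N) (2^-1 : R) ^+ j <= 2.
Proof.
suff -> : \sum_(j < N) (2^-1 : R) ^+ j = 2 - 2 * 2^-1 ^+ N.
  by rewrite gerBl mulr_ge0// exprn_ge0.
elim: N => [|N IH]; first by rewrite big_ord0 expr0 mulr1 subrr.
by rewrite big_ord_recr /= IH exprS; field.
Qed.

(** Summation by parts writes a sum weighted by [w] as a combination of the
    partial sums with the nonnegative coefficients [w n - w n.+1]. The induction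
    carries the boundary term [w N * (X - Y)], which only shrinks when [w]
    decreases. *)
Lemma ler_sum_abel (R : realType) (w x y : nat -> R) (N : nat) :
  (forall n, 0 <= w n) -> nonincreasing_seq w ->
  (forall m, (m <= N)%N -> \sum_(i < m) y i <= \sum_(i < m) x i) ->
  \sum_(i < N) w i * y i <= \sum_(i < N) w i * x i.
Proof.
move=> w0 w_dec; case: N => [_|N le_yx]; first by rewrite !big_ord0.
suff: w N * (\sum_(i < N.+1) x i - \sum_(i < N.+1) y i) <=
      \sum_(i < N.+1) w i * x i - \sum_(i < N.+1) w i * y i.
  move=> H; rewrite -subr_ge0; apply: le_trans H.
  by rewrite mulr_ge0// subr_ge0 le_yx.
elim: N le_yx => [|N IH] le_yx.
  by rewrite !big_ord_recr !big_ord0 /= !add0r mulrBr.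
have {}IH := IH (fun m mN => le_yx m (leqW mN)).
have D0 := le_yx N.+1 (leqnSn _).
rewrite 4!(big_ord_recr N.+1) /=.
move: IH D0; set X := \sum_(i < N.+1) x i; set Y := \sum_(i < N.+1) y i.
set WX := \sum_(i < _) _ * _; set WY := \sum_(i < _) _ * _ => IH D0.
have : w N.+1 * (X - Y) <= w N * (X - Y).
  by rewrite ler_wpM2r ?subr_ge0// w_dec.
by rewrite !mulrBr !mulrDr => H; rewrite !mulrBr in IH; lra.
Qed.

(** The terms of rank [0, ..., size s - 1] are the largest ones. A list without
    repetition contains an index at least as large as [size s - 1]; that index is
    paid by the last term on the right, and the rest of the list by induction. *)
Lemma ler_sum_uniq (R : realType) (x : nat -> R) (s : seq nat) :
  nonincreasing_seq x -> uniq s ->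
  \sum_(i <- s) x i <= \sum_(i < size s) x i.
Proof.
move=> x_dec; have [n ns] := ubnP (size s).
elim: n s ns => // n IH [|i0 s0]; first by rewrite big_nil big_ord0.
set s := i0 :: s0 => sn s_uniq.
(* Otherwise s would inject into the numbers below [size s - 1]. *)
have [m ms sm] : exists2 m, m \in s & (size s0 <= m)%N.
  apply/hasP; apply/negPn/negP => /hasPn s_small.
  have : {subset s <= iota 0 (size s0)}.
    by move=> i /s_small; rewrite mem_iota /= -ltnNge.
  by move/(uniq_leq_size s_uniq); rewrite size_iota /s /= ltnn.
rewrite (_ : size s = (size s0).+1)// big_ord_recr /=.
rewrite (perm_big _ (perm_to_rem ms)) big_cons addrC lerD//.
  exact: x_dec.
have s_rem : size (rem m s) = size s0 by rewrite size_rem.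
by rewrite -s_rem; apply: IH; rewrite ?rem_uniq ?s_rem.
Qed.

(** Rearrangement inequality: the partial sums of the rearranged sequence are sums
    over distinct indices, hence at most those of [x], and summation by parts
    transfers this to the sums weighted by [w]. *)
Lemma ler_sum_rearrange (R : realType) (w x : nat -> R) (P : pred nat)
    (g : nat -> nat) (N : nat) :
  (forall n, 0 <= w n) -> nonincreasing_seq w ->
  (forall n, 0 <= x n) -> nonincreasing_seq x ->
  {in P &, injective g} ->
  \sum_(i < N | P i) w i * x (g i) <= \sum_(i < N) w i * x i.
Proof.
move=> w0 w_dec x0 x_dec g_inj.
have -> : \sum_(i < N | P i) w i * x (g i) =
          \sum_(i < N) w i * (if P i then x (g i) else 0).
  by rewrite big_mkcond; apply: eq_bigr => i _; case: ifP; rewrite ?mulr0.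
apply: (ler_sum_abel (y := fun i => if P i then x (g i) else 0)) => // m _.
rewrite -big_mkcond /= -(big_mkord P (fun i => x (g i))) /index_iota subn0.
rewrite -big_filter -(big_map g predT).
set s := [seq g i | i <- _].
have s_uniq : uniq s.
  rewrite map_inj_in_uniq ?filter_uniq ?iota_uniq// => i j.
  by rewrite !mem_filter => /andP[Pi _] /andP[Pj _]; exact: g_inj.
have s_le : (size s <= m)%N.
  by rewrite size_map size_filter (leq_trans (count_size _ _))// size_iota.
apply: (le_trans (ler_sum_uniq x_dec s_uniq)).
rewrite -!(big_mkord predT) [leRHS](big_cat_nat (n := size s))//= lerDl.
exact: sumr_ge0.
Qed.

(** * Series with nonnegative terms *)

Lemma nneseries_leP (R : realType) (u : nat -> R) (M : R) :
  (forall n, 0 <= u n) ->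
  (\sum_(0 <= n <oo) (u n)%:E <= M%:E)%E <->
  (forall N, \sum_(i < N) u i <= M).
Proof.
move=> u0; split=> [le_uM N|le_uM].
  rewrite -lee_fin -sumEFin; apply: le_trans le_uM.
  rewrite -(big_mkord predT (fun i => (u i)%:E)).
  by apply: nneseries_lim_ge => n _ _; rewrite lee_fin.
apply: lime_le; first by apply: is_cvg_nneseries => n _ _; rewrite lee_fin.
by apply: nearW => N; rewrite big_mkord sumEFin lee_fin.
Qed.

Lemma nneseries_ltyP (R : realType) (u : nat -> R) :
  (forall n, 0 <= u n) ->
  (\sum_(0 <= n <oo) (u n)%:E < +oo)%E <->
  (exists M, forall N, \sum_(i < N) u i <= M).
Proof.
move=> u0; split=> [|[M /(nneseries_leP _ u0) le_uM]].
  have : (0 <= \sum_(0 <= n <oo) (u n)%:E)%E.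
    by apply: nneseries_ge0 => n _ _; rewrite lee_fin.
  case E : (\sum_(0 <= n <oo) (u n)%:E)%E => [M| |]// _ _.
  by exists M; apply/nneseries_leP => //; rewrite E.
exact: le_lt_trans le_uM (ltry _).
Qed.

Lemma summable_idealP (R : realType) (a : nat -> R) (C : set nat) :
  (forall n, 0 <= a n) ->
  summable_ideal a C <->
  (exists M, forall N, \sum_(i < N | val i \in C) a i <= M).
Proof.
move=> a0; rewrite /summable_ideal /= /phi.
rewrite -{1}(set_mem_set C) -nneseries_esum; last by move=> n _; rewrite lee_fin.
rewrite eseries_mkcond.
under eq_eseriesr => n _ do rewrite -(fun_if EFin).
rewrite nneseries_ltyP => [|n]; last by case: ifP.
have sumE N : \sum_(i < N | val i \in C) a i =
    \sum_(i < N) (if val i \in C then a i else 0) by rewrite big_mkcond.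
by split=> -[M le_M]; exists M => N; move: (le_M N); rewrite sumE.
Qed.

Lemma sum_tail_le (R : realType) (u : nat -> R) (M e : R) :
  0 < e -> (forall N, \sum_(i < N) u i <= M) ->
  exists N0, forall N, \sum_(i < N) u i <= \sum_(i < N0) u i + e.
Proof.
move=> e_gt0 le_M; pose E := range (fun N => \sum_(i < N) u i).
have E_sup : has_sup E.
  by split; [exists (\sum_(i < 0) u i), 0 | exists M => _ [N _ <-]].
have [_ [N0 _ <-] N0_sup] := sup_adherent e_gt0 E_sup.
exists N0 => N; rewrite -lerBlDr; apply: le_trans (ltW N0_sup).
by rewrite lerD2r; apply: ub_le_sup; [exact: E_sup.2 | exists N].
Qed.

Lemma hphi_eq_sum (R : realType) (a x : nat -> R) (N : nat) :
  (forall n, 0 <= a n) -> (forall n, (N <= n)%N -> x n = 0) ->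
  hphi a x = (\sum_(i < N) a i * `|x i|)%:E.
Proof.
move=> a0 xN; rewrite hphiE// (nneseries_split 0 N); last first.
  by move=> k _; rewrite lee_fin mulr_ge0.
rewrite add0n big_mkord sumEFin eseries0 ?adde0// => i Ni _.
by rewrite xN// normr0 mulr0.
Qed.

Lemma hphi_ltyP (R : realType) (a x : nat -> R) :
  (forall n, 0 <= a n) ->
  (hphi a x < +oo)%E <->
  (exists M, forall N, \sum_(i < N) a i * `|x i| <= M).
Proof.
by move=> a0; rewrite hphiE// nneseries_ltyP// => n; rewrite mulr_ge0.
Qed.

(** For the summable ideals both spaces consist of the monotone sequences with
    [sum a n * |x n| < oo]: the tails of a convergent series vanish, and one
    finite tail bounds the whole series. *)
Lemma mEXH_mFIN (R : realType) (a : nat -> R) :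
  (forall n, 0 <= a n) -> mEXH a = mFIN a.
Proof.
move=> a0.
have ax0 (x : nat -> R) k : (0 <= (a k * `|x k|)%:E)%E.
  by rewrite lee_fin mulr_ge0.
have tailE (x : nat -> R) n : hphi a (x \* \1_[set k : nat | (n <= k)%N]) =
    (\sum_(n <= k <oo) (a k * `|x k|)%:E)%E.
  rewrite hphiE// [RHS]eseries_cond [RHS]eseries_mkcond.
  apply: eq_eseriesr => k _; rewrite [in LHS]/= indicE.
  have -> : (k \in [set j : nat | (n <= j)%N]) = (n <= k)%N.
    by apply/idP/idP; rewrite inE.
  by case: (n <= k)%N; rewrite ?mulr1 ?mulr0 ?normr0 ?mulr0.
apply/seteqP; split=> x [x_mon].
  under eq_cvg do rewrite tailE.
  move=> tail0; split=> //.
  have /(tail0 _)[n _ /(_ n (leqnn n))] /= : nbhs 0%E [set y : \bar R | (y < 1%:E)%E].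
    by apply: open_nbhs_nbhs; split; [exact: open_ereal_lt_ereal | rewrite /= lte_fin].
  move=> tail1; rewrite hphiE// (nneseries_split 0 n)//.
  by rewrite sumEFin add0n lte_add_pinfty ?ltry// (lt_trans tail1) ?ltry.
move=> x_fin; split=> //; under eq_cvg do rewrite tailE.
by apply: nneseries_tail_cvg => //; rewrite -hphiE.
Qed.

(** * From partial sums to the Katetov order *)

Lemma sum_ratio_leP (R : realType) (a b : nat -> R) (eta : R) :
  (forall n, 0 < a n) ->
  (forall n, (\sum_(i < n.+1) b i) / (\sum_(i < n.+1) a i) <= eta) <->
  (forall n, \sum_(i < n) b i <= eta * \sum_(i < n) a i).
Proof.
move=> a_gt0.
have A_gt0 n : 0 < \sum_(i < n.+1) a i.
  by rewrite big_ord_recr /= ltr_wpDl// sumr_ge0// => i _; exact: ltW.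
split=> [H [|n]|H n]; last by rewrite ler_pdivrMr.
  by rewrite !big_ord0 mulr0.
by rewrite -ler_pdivrMr.
Qed.

(** Put [A n] and [B n] for the sums of the first [n] terms, and cut the half-line
    at the points [2 * eta * A n]. The map [f] sends [k] to the slot that contains
    [B k], the left end of the interval [[B k, B k.+1]] of length [b k]. Every
    fiber of [f] then has [b]-mass at most the length [2 * eta * a n] of its slot
    plus the length of the last interval, which may stick out to the right. The
    factor 2 controls the latter, see [b_le]. *)
Section Katetov_map.
Variables (R : realType) (a b : nat -> R) (eta : R).
Hypotheses (eta_gt0 : 0 < eta) (a_gt0 : forall n, 0 < a n)
  (b_gt0 : forall n, 0 < b n) (a_dec : nonincreasing_seq a)
  (b_dec : nonincreasing_seq b)
  (le_BA : forall n, \sum_(i < n) b i <= eta * \sum_(i < n) a i).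

Let A n := \sum_(i < n) a i.
Let B n := \sum_(i < n) b i.

Let A_mono m n : (m <= n)%N -> A m <= A n.
Proof. by apply: ler_sum_nat_mono => k; exact: ltW. Qed.

Let B_mono m n : (m <= n)%N -> B m <= B n.
Proof. by apply: ler_sum_nat_mono => k; exact: ltW. Qed.

Let A_ge0 n : 0 <= A n.
Proof. by apply: sumr_ge0 => i _; exact: ltW. Qed.

Let AS n : A n.+1 = A n + a n.
Proof. by rewrite /A big_ord_recr. Qed.

Let BS n : B n.+1 = B n + b n.
Proof. by rewrite /B big_ord_recr. Qed.

Let ex_slot k : exists n, B k < 2 * eta * A n.+1.
Proof.
exists k; apply: (le_lt_trans (le_BA k)); rewrite -mulrA mulr_natl mulr2n.
rewrite -/(A k) -[ltLHS]addr0 ler_ltD ?ler_pM2l ?A_mono//.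
by rewrite mulr_gt0// AS ltr_wpDl.
Qed.

Let f k := ex_minn (ex_slot k).

Let f_ub k : B k < 2 * eta * A (f k).+1.
Proof. by rewrite /f; case: ex_minnP. Qed.

Let f_lb k : 2 * eta * A (f k) <= B k.
Proof.
rewrite /f; case: ex_minnP => -[|n] _ n_min.
  by rewrite /A big_ord0 mulr0 sumr_ge0// => i _; exact: ltW.
by rewrite leNgt; apply/negP => /n_min; rewrite ltnn.
Qed.

Let f_le k : (f k <= k)%N.
Proof.
rewrite leqNgt; apply/negP => kf.
have H1 : A k.+1 <= A (f k) := A_mono kf.
have H2 := f_lb k; have H3 := le_BA k; rewrite -/(A k) -/(B k) in H3.
have H4 : eta * A k < eta * A (f k).
  by rewrite ltr_pM2l//; apply: lt_le_trans H1; rewrite AS ltrDl.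
have H5 : 0 <= eta * A (f k) by rewrite mulr_ge0// ltW.
by rewrite -mulrA mulr_natl mulr2n in H2; lra.
Qed.

(** If [b k] exceeded [2 * eta * a n] for [n = f k], then from rank [n] to [k] the
    sum of [eta * a] would grow by less than [B k.+1 / 2], because all earlier
    terms of [b] are at least [b k]. But [eta * A n] is at most [B k / 2], so
    [eta * A k.+1 < B k.+1], against the hypothesis. *)
Let b_le k : b k <= 2 * eta * a (f k).
Proof.
rewrite leNgt; apply/negP => lt_ab.
have A_le : A k.+1 <= A (f k) + k.+1%:R * a (f k).
  rewrite /A -(big_mkord predT) (big_cat_nat (n := f k))//=; last first.
    exact: leqW (f_le k).
  rewrite big_mkord lerD2l (@le_trans _ _ (\sum_(f k <= i < k.+1) a (f k)))//.
    by rewrite big_nat [leRHS]big_nat; apply: ler_sum => i /andP[fi _]; exact: a_dec.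
  rewrite sumr_const_nat -[leLHS]mulr_natl ler_wpM2r ?ler_nat ?leq_subr//.
  exact: ltW.
have B_ge : k.+1%:R * b k <= B k.+1.
  rewrite mulr_natl -{1}(card_ord k.+1) -sumr_const; apply: ler_sum => i _.
  by apply: b_dec; rewrite -ltnS.
have H1 : eta * A k.+1 <= eta * A (f k) + eta * (k.+1%:R * a (f k)).
  by rewrite -mulrDr ler_pM2l.
have H2 : k.+1%:R * (2 * eta * a (f k)) < k.+1%:R * b k by rewrite ltr_pM2l.
have H3 := le_BA k.+1; rewrite -/(A _) -/(B _) in H3.
have H4 := f_lb k; have H5 := BS k; have H6 := b_gt0 k.
have E1 : k.+1%:R * (2 * eta * a (f k)) = 2 * (eta * (k.+1%:R * a (f k))) by ring.
have E2 : 2 * eta * A (f k) = 2 * (eta * A (f k)) by ring.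
by rewrite E1 in H2; rewrite E2 in H4; lra.
Qed.

Let fiber_le n N : \sum_(k < N | f k == n) b k <= 4 * eta * a n.
Proof.
(* The first bound locates the mass collected so far inside the slot; it is
   what the second one needs when a new interval is added. *)
suff [] : \sum_(k < N | f k == n) b k <= Num.max 0 (B N - 2 * eta * A n) /\
   \sum_(k < N | f k == n) b k <= 4 * eta * a n by [].
elim: N => [|N [IH1 IH2]].
  by rewrite big_ord0 le_max lexx; split => //; rewrite !mulr_ge0 ?ltW.
rewrite big_mkcond big_ord_recr /= -big_mkcond /=.
case: eqP => [fN|_]; last first.
  rewrite addr0; split => //; apply: (le_trans IH1).
  by rewrite ge_max !le_max lexx /= lerD2r B_mono ?orbT.
have := f_lb N; have := f_ub N; have := b_le N; have := BS N; rewrite fN AS.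
move: IH1; rewrite le_max => /orP[] IH1 H1 H2 H3 H4; rewrite mulrDr in H3;
 (split; first by rewrite le_max; apply/orP; right; lra).
 have -> : 4 * eta * a n = 2 * eta * a n + 2 * eta * a n by ring.
 have : 0 <= 2 * eta * a n by rewrite !mulr_ge0 ?ltW.
 lra.
have -> : 4 * eta * a n = 2 * eta * a n + 2 * eta * a n by ring.
lra.
Qed.

Lemma Katetov_of_sum_le : Katetov_le (summable_ideal a) (summable_ideal b).
Proof.
exists f => C /(summable_idealP C (fun n => ltW (a_gt0 n)))[M le_M].
apply/(summable_idealP _ (fun n => ltW (b_gt0 n))).
exists (4 * eta * M) => N.
pose g (k : 'I_N) : 'I_N := Ordinal (leq_ltn_trans (f_le k) (ltn_ord k)).
rewrite (partition_big g (fun n => val n \in C)) /=; last first.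
  by move=> k; rewrite !inE.
apply: (@le_trans _ _ (\sum_(n < N | val n \in C) 4 * eta * a n)); last first.
  by rewrite -mulr_sumr ler_pM2l// mulr_gt0.
apply: ler_sum => n nC; apply: le_trans (fiber_le n N).
rewrite [leLHS]big_mkcond [leRHS]big_mkcond; apply: ler_sum => k _ /=.
rewrite -val_eqE /=; case: (f k == n); rewrite ?andbF// andbT.
by case: ifP => // _; exact: ltW.
Qed.

End Katetov_map.

(** * From the Katetov order to partial sums *)

(** Call [m F] the [b]-mass of the preimage of [F] under a Katetov map [f]. A gliding
    hump shows that [m F <= 1] as soon as [F] lies far enough and has small enough
    [a]-mass. When [a] tends to 0, a far set can be chopped into pieces of such
    [a]-mass, so [m F] is at most linear in the [a]-mass of [F]. Now the image of
    [{0, ..., k-1}] has at most [k] elements, hence [a]-mass at most the sum of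
    the first [k] terms of [a], and this bounds the sum of the first [k] terms of
    [b]. *)
Section from_Katetov.
Variables (R : realType) (a b : nat -> R) (f : nat -> nat).
Hypotheses (a_gt0 : forall n, 0 < a n) (b_gt0 : forall n, 0 < b n)
  (a_dec : nonincreasing_seq a) (b_dec : nonincreasing_seq b)
  (f_Katetov : forall C, summable_ideal a C -> summable_ideal b (f @^-1` C)).

Let a_ge0 n : 0 <= a n := ltW (a_gt0 n).
Let b_ge0 n : 0 <= b n := ltW (b_gt0 n).

Let preimage_bounded (C : set nat) (M : R) :
  (forall N, \sum_(i < N | val i \in C) a i <= M) ->
  exists M', forall N, \sum_(i < N | f i \in C) b i <= M'.
Proof.
move=> le_M; have /f_Katetov : summable_ideal a C.
  by apply/summable_idealP => //; exists M.
by move/(summable_idealP _ b_ge0) => [M' le_M']; exists M' => N; exact: le_M'.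
Qed.

(** Sets [P_j] violating the claim for every [j] have a union [C] in the ideal of
    [a], as their [a]-masses are at most [2^-j]. The preimage of [C] therefore has
    finite [b]-mass, and all of it but 1 comes from finitely many [i]. For [j]
    larger than all [f i] of these [i], the hump [P_j] has its whole mass, which
    is more than 1, in the remaining part. *)
Let gliding_hump :
  exists j, forall P : pred nat, (forall n, P n -> (j <= n)%N) ->
    (forall N, \sum_(i < N | P i) a i <= 2^-1 ^+ j) ->
    forall k, \sum_(i < k | P (f i)) b i <= 1.
Proof.
apply: contrapT => /forallNP no_j.
have {no_j} : forall j, exists Pk : pred nat * nat,
    [/\ forall n, Pk.1 n -> (j <= n)%N,
        forall N, \sum_(i < N | Pk.1 i) a i <= 2^-1 ^+ j
      & 1 < \sum_(i < Pk.2 | Pk.1 (f i)) b i].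
  move=> j; apply: contrapT => /forallNP no_Pk; apply: (no_j j) => P P_ge P_a k.
  by rewrite leNgt; apply/negP => P_b; exact: (no_Pk (P, k)).
move=> /choice[F F_hump].
pose C : set nat := [set n | exists j, (F j).1 n].
have C_a N : \sum_(i < N | val i \in C) a i <= 2.
  apply: le_trans (sum_half_le R N).
  apply: (@le_trans _ _ (\sum_(j < N) \sum_(i < N | (F j).1 i) a i)); last first.
    by apply: ler_sum => j _; have [_ + _] := F_hump j; exact.
  under [leRHS]eq_bigr => j _ do rewrite big_mkcond /=.
  rewrite exchange_big big_mkcond /=; apply: ler_sum => i _.
  case: ifPn => [|_]; last by apply: sumr_ge0 => j _; case: ifP.
  rewrite inE => -[j Fj_i]; have [/(_ _ Fj_i) ji _ _] := F_hump j.
  rewrite (bigD1 (Ordinal (leq_ltn_trans ji (ltn_ord i)))) //= Fj_i lerDl.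
  by apply: sumr_ge0 => ? _; case: ifP.
have [M C_b] := preimage_bounded C_a.
pose u i := if f i \in C then b i else 0.
have uE N : \sum_(i < N) u i = \sum_(i < N | f i \in C) b i.
  by rewrite [RHS]big_mkcond.
have [N0 N0_tail] : exists N0, forall N, \sum_(i < N) u i <= \sum_(i < N0) u i + 1.
  by apply: (@sum_tail_le _ _ M) => // N; rewrite uE.
have [Fj_ge _] := F_hump (\max_(i < N0) f i).+1.
set j := (X in F X); set k := (F j).2; rewrite ltNge => /negP; apply.
have := N0_tail (N0 + k)%N.
rewrite -[X in X <= _ -> _](big_mkord predT) (big_cat_nat (n := N0))//=; last first.
  exact: leq_addr.
rewrite big_mkord lerD2l; apply: le_trans.
rewrite -(big_mkord (fun i => (F j).1 (f i))) big_mkcond /=.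
apply: (@le_trans _ _ (\sum_(0 <= i < N0 + k) if (F j).1 (f i) then b i else 0)).
  rewrite [leRHS](big_cat_nat (n := k)) ?leq_addl//= lerDl.
  by apply: sumr_ge0 => i _; case: ifP.
rewrite (big_cat_nat (n := N0)) ?leq_addr//= big_mkord big1 ?add0r => [|i _].
  apply: ler_sum => i _; rewrite /u; case: ifPn => [Fj_fi|_]; last by case: ifP.
  by rewrite ifT// inE; exists j.
case: ifP => // /Fj_ge; rewrite ltnNge => /negP[].
by apply: (leq_bigmax (F := fun i : 'I_N0 => f i)).
Qed.

(** The first [N1] indices, where [a] may be large, form a set in the ideal of [a], so
    their preimage contributes a constant. *)
Let vanishing_case :
  (forall e, 0 < e -> exists n, a n < e) ->
  exists eta, forall k, \sum_(i < k) b i <= eta * \sum_(i < k) a i.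
Proof.
move=> a_small; have [j hump] := gliding_hump.
set d : R := 2^-1 ^+ j in hump; have d_gt0 : 0 < d by rewrite exprn_gt0.
have [N1 [jN1 a_le]] : exists N1, (j <= N1)%N /\
    forall n, (N1 <= n)%N -> a n <= d / 2.
  have [n0 n0_small] := a_small (d / 2) (divr_gt0 d_gt0 (ltr0Sn _ 1)).
  exists (maxn j n0); split=> [|n]; first exact: leq_maxl.
  by rewrite geq_max => /andP[_ /a_dec n0n]; exact: (le_trans n0n (ltW n0_small)).
have chop (P : pred nat) k n : (forall n, P n -> (N1 <= n)%N) ->
    \sum_(i < k | P (f i) && (f i < n)%N) b i <= 1 + 2 / d * \sum_(i < n | P i) a i.
  move=> P_ge.
  have piece p m : \sum_(i < m | P i && (p <= i)%N) a i <= d ->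
      \sum_(i < k | P (f i) && (p <= f i < m)%N) b i <= 1.
    move=> piece_a; apply: (hump (fun i => P i && (p <= i < m)%N)).
      by move=> i /andP[/P_ge + _]; exact: leq_trans.
    move=> N; apply: le_trans piece_a.
    rewrite (big_ord_widen_cond (N + m)
      (fun i => P i && (p <= i < m)%N) a (leq_addr m N)).
    rewrite (big_ord_widen_cond (N + m)
      (fun i => P i && (p <= i)%N) a (leq_addl N m)).
    by apply: ler_sum_subpred => // i /andP[/and3P[-> -> ->]].
  (* Greedy chopping: [p] is the start of the piece under construction. A piece
     is closed when its [a]-mass is about to exceed [d]; it is then more than
     [d / 2], as single terms are at most [d / 2], and pays for [b]-mass 1. *)
  suff [p [pn b_p a_p]] : exists p, [/\ (p <= n)%N,
      \sum_(i < k | P (f i) && (f i < p)%N) b i <= 2 / d * \sum_(i < p | P i) a i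
    & \sum_(i < n | P i && (p <= i)%N) a i <= d].
    rewrite (bigID (fun i : 'I_k => (f i < p)%N)) /= addrC lerD//.
      apply: le_trans (piece _ _ a_p); apply: ler_sum_subpred => // i.
      by rewrite -leqNgt => /andP[/andP[-> ->] ->].
    apply: (@le_trans _ _ (\sum_(i < k | P (f i) && (f i < p)%N) b i)).
      by apply: ler_sum_subpred => // i /andP[/andP[-> _] ->].
    apply: (le_trans b_p); rewrite ler_pM2l ?divr_gt0//.
    rewrite (big_ord_widen_cond n P a pn).
    by apply: ler_sum_subpred => // i /andP[].
  elim: n => [|n [p [pn b_p a_p]]].
    exists 0%N; rewrite !big_ord0 mulr0; split=> //; last exact: ltW.
    by rewrite big1// => i; rewrite ltn0 andbF.
  have [a_pS|a_pS] := leP (\sum_(i < n.+1 | P i && (p <= i)%N) a i) d.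
    by exists p; split=> //; exact: leqW.
  have Sum_n m : \sum_(i < n.+1 | P i && (m <= i)%N) a i =
      \sum_(i < n | P i && (m <= i)%N) a i + (if P n && (m <= n)%N then a n else 0).
    by rewrite [in LHS]big_mkcond big_ord_recr /= -big_mkcond.
  have last_le : (if P n && (p <= n)%N then a n else 0) <= d / 2.
    by case: ifP => [/andP[/P_ge/a_le]//|_]; rewrite divr_ge0 ?ltW.
  exists n; split; first exact: leqnSn.
    rewrite (bigID (fun i : 'I_k => (f i < p)%N)) /=.
    rewrite (bigID (fun i : 'I_n => (i < p)%N)) /= mulrDr lerD//.
      rewrite -(big_ord_widen_cond _ _ _ pn); apply: le_trans b_p.
      by apply: ler_sum_subpred => // i /andP[/andP[-> _] ->].
    apply: (@le_trans _ _ 1).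
      apply: le_trans (piece _ _ a_p); apply: ler_sum_subpred => // i.
      by rewrite -leqNgt => /andP[/andP[-> ->] ->].
    under eq_bigl => i do rewrite -leqNgt.
    rewrite mulrAC ler_pdivlMr// mul1r.
    by move: a_pS; rewrite Sum_n; lra.
  rewrite Sum_n leqnn andbT big1 ?add0r => [|i /andP[_]]; last first.
    by rewrite leqNgt ltn_ord.
  by case: ifP => [/P_ge/a_le|_]; lra.
have [K K_b] : exists K, forall N, \sum_(i < N | f i \in `I_N1) b i <= K.
  apply: (@preimage_bounded _ (\sum_(i < N1) a i)) => N.
  apply: (@le_trans _ _ (\sum_(i < N | (i < N1)%N) a i)).
    by apply: ler_sum_subpred => // i; rewrite inE.
  rewrite (big_ord_widen_cond (N + N1)
    (fun i => (i < N1)%N) a (leq_addr N1 N)).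
  rewrite [leRHS](big_ord_widen_cond (N + N1) predT a (leq_addl N N1)).
  by apply: ler_sum_subpred => // i /andP[].
have main k : \sum_(i < k) b i <= K + (1 + 2 / d * \sum_(i < k) a i).
  rewrite (bigID (fun i : 'I_k => f i \in `I_N1)) lerD//.
    exact: K_b.
  pose n := (\max_(i < k) f i).+1.
  pose P m := (N1 <= m)%N && (m \in [seq f i | i <- iota 0 k]).
  apply: (@le_trans _ _ (\sum_(i < k | P (f i) && (f i < n)%N) b i)).
    apply: ler_sum_subpred => // i /andP[_ /negP fi].
    have N1f : (N1 <= f i)%N.
      by rewrite leqNgt; apply/negP => ?; apply: fi; rewrite inE.
    rewrite /P N1f map_f ?mem_iota//= /n ltnS.
    exact: (leq_bigmax (F := fun i : 'I_k => f i)).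
  apply: (le_trans (chop P k n _)); first by move=> m /andP[].
  rewrite lerD2l ler_pM2l ?divr_gt0//.
  rewrite -(big_mkord P) -big_filter.
  set s := [seq i <- _ | _].
  have s_uniq : uniq s by rewrite filter_uniq// iota_uniq.
  apply: (le_trans (ler_sum_uniq a_dec s_uniq)); apply: ler_sum_nat_mono => //.
  rewrite -[k in (_ <= k)%N](size_iota 0) -(size_map f (iota 0 k)); apply: uniq_leq_size => //.
  by move=> m; rewrite mem_filter => /andP[/andP[]].
exists (2 / d + (`|K| + 1) / a 0%N) => -[|k]; first by rewrite !big_ord0 mulr0.
apply: (le_trans (main _)); rewrite [leRHS]mulrDl.
suff : K + 1 <= (`|K| + 1) / a 0%N * \sum_(i < k.+1) a i by lra.
rewrite mulrAC ler_pdivlMr//; apply: (@le_trans _ _ ((`|K| + 1) * a 0%N)).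
  by rewrite ler_pM2r// lerD2r ler_norm.
rewrite ler_pM2l ?ltr_wpDl// big_ord_recl lerDl.
exact: sumr_ge0.
Qed.

Lemma sum_le_of_Katetov :
  exists eta, forall k, \sum_(i < k) b i <= eta * \sum_(i < k) a i.
Proof.
have [/vanishing_case//|] := pselect (forall e, 0 < e -> exists n, a n < e).
(* Here [a] is bounded below by [e], and the sum of [k] terms of [b] is trivially
   at most [k * b 0]. *)
move=> /existsNP[e /not_implyP[e_gt0 /forallNP a_ge]].
exists (b 0%N / e) => k; rewrite mulr_sumr; apply: ler_sum => i _.
apply: (@le_trans _ _ (b 0%N)); first exact: b_dec.
rewrite mulrAC ler_pdivlMr// ler_pM2l//.
by rewrite leNgt; apply/negP/a_ge.
Qed.

End from_Katetov.

(** * Domination on monotone sequences *)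

(** Summation by parts, with the nonincreasing sequence [|x n|] as weights. *)
Lemma mono_dominated_of_sum_le (R : realType) (a b : nat -> R) (eta : R) :
  (forall n, 0 <= a n) -> (forall n, 0 <= b n) -> 0 < eta ->
  (forall n, \sum_(i < n) b i <= eta * \sum_(i < n) a i) ->
  mono_dominated b a.
Proof.
move=> a0 b0 eta_gt0 le_BA; exists eta => // n x x_mon.
have x_out i : (n.+1 <= i)%N -> (nth 0 x i) = 0.
  by move=> ni; rewrite nth_default// size_tuple.
rewrite !(hphi_eq_sum (N := n.+1))// -EFinM lee_fin mulr_sumr.
under eq_bigr do rewrite mulrC.
under [leRHS]eq_bigr do rewrite mulrA mulrC.
apply: (@ler_sum_abel _ (fun i => `|nth 0 x i|) (fun i => eta * a i)) => //.
  apply/nonincreasing_seqP => i.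
  have [i_n|n_i] := ltnP i.+1 n.+1; last by rewrite (x_out i.+1)// normr0.
  have := x_mon (Ordinal (ltnW i_n)) (Ordinal i_n) (leqnSn _).
  by rewrite !(tnth_nth 0).
by move=> m _; rewrite -mulr_sumr.
Qed.

(** * Functions of bounded variation *)

(** Among all enumerations of the first [N] intervals, the [b]-weighted sum of the
    oscillations is largest when these decrease, and then the domination on
    monotone sequences applies. The sum weighted by [a] that it produces belongs
    to a reordering of the same intervals, so the [a]-variation bounds it. *)
Lemma mono_dominated_BV (R : realType) (a b : nat -> R) :
  (forall n, 0 <= a n) -> (forall n, 0 <= b n) -> nonincreasing_seq b ->
  mono_dominated b a -> BV a `<=` BV b.
Proof.
move=> a0 b0 b_dec [K K_gt0 le_ba] x [M M_gt0 le_xM].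
exists (K * M) => [|s t st disj]; first exact: mulr_gt0.
pose c n := `|x (t n) - x (s n)|.
have c_ge0 n : 0 <= c n by exact: normr_ge0.
apply/nneseries_leP => [n|[|n]]; first exact: mulr_ge0.
  by rewrite big_ord0 mulr_ge0// ltW.
set N := n.+1.
pose r := sort (fun i j => c j <= c i) (iota 0 N).
have r_perm : perm_eq r (iota 0 N) by rewrite perm_sort.
have r_mem i : (i \in r) = (i < N)%N by rewrite (perm_mem r_perm) mem_iota.
have r_size : size r = N by rewrite size_sort size_iota.
have r_uniq : uniq r by rewrite (perm_uniq r_perm) iota_uniq.
pose z i := if (i < N)%N then c (nth 0%N r i) else 0.
have z_ge0 i : 0 <= z i by rewrite /z; case: ifP.
have z_dec : nonincreasing_seq z.
  apply/nonincreasing_seqP => i; rewrite {1}/z; case: ifP => // i_N.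
  rewrite /z ltnW//.
  have /(sortedP 0%N) : sorted (fun i j => c j <= c i) r.
    by apply: sort_sorted => ? ?; exact: le_total.
  by apply; rewrite r_size.
apply: (@le_trans _ _ (\sum_(i < N) b i * z i)).
  have z_index i : (i < N)%N -> c i = z (index i r).
    move=> i_N; have i_r : i \in r by rewrite r_mem.
    by rewrite /z -{1}r_size index_mem i_r nth_index.
  rewrite (eq_bigr (fun i : 'I_N => b i * z (index (i : nat) r))); last first.
    by move=> i _; rewrite -z_index.
  rewrite (eq_bigl (fun i : 'I_N => (i < N)%N)); last by move=> i; rewrite ltn_ord.
  apply: (@ler_sum_rearrange _ b z (fun i => (i < N)%N) (fun i => index i r)) => //.
  by move=> i j i_N j_N; apply: (index_inj 0%N); rewrite r_mem.
pose y := [tuple z i | i < N].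
have yE i : nth 0 y i = z i.
  have [i_N|N_i] := ltnP i N; first by rewrite (nth_mktuple _ _ (Ordinal i_N)).
  by rewrite nth_default ?size_tuple// /z ltnNge N_i.
have z_out i : (N <= i)%N -> nth 0 y i = 0.
  by move=> N_i; rewrite yE /z ltnNge N_i.
have sum_yE (w : nat -> R) : \sum_(i < N) w i * `|nth 0 y i| = \sum_(i < N) w i * z i.
  by apply: eq_bigr => i _; rewrite yE ger0_norm.
have := le_ba n y; rewrite !(hphi_eq_sum (N := N))// -EFinM lee_fin !sum_yE => le_z.
apply: le_trans (le_z _) _ => [i j ij|].
  by rewrite !tnth_mktuple !ger0_norm//; exact: z_dec.
rewrite ler_pM2l//.
(* The reordering fixes the indices from [N] on, so that it permutes the whole
   sequence of intervals. *)
pose p i := if (i < N)%N then nth 0%N r i else i.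
have p_lt i : (p i < N)%N = (i < N)%N.
  by rewrite /p; case: ifP => // i_N; rewrite -r_mem mem_nth ?r_size.
have p_inj : injective p.
  move=> i j pij; have ij : (i < N)%N = (j < N)%N by rewrite -p_lt pij p_lt.
  move: pij; rewrite /p -ij; case: ifP => // i_N /eqP.
  by rewrite nth_uniq ?r_size -?ij// => /eqP.
have disj_p : trivIset setT
    (fun i => [set` `[set_val ((s \o p) i), set_val ((t \o p) i)]]°).
  by move=> i j _ _ /(disj (p i) (p j) I I)/p_inj.
have := le_xM (s \o p) (t \o p) (fun i => st (p i)) disj_p.
rewrite nneseries_leP => [le_p|i]; last exact: mulr_ge0.
apply: le_trans (le_p N); apply: ler_sum => i _.
by rewrite /z /c /= /p ltn_ord.
Qed.

(** A sequence [x] is turned into a function on the unit interval with value [|x n|] at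
    the point [1 / (2 n + 1)] and 0 elsewhere. The points [1 / (2 n + 2)] in between,
    where it vanishes, separate the spikes. *)
Section spike.
Variables (R : realType) (x : nat -> R).

Definition unit_frac (n : nat) : R := n.+1%:R^-1.

Definition spike_index (p : R) : nat :=
  xget 0%N [set n | unit_frac n.*2 = p].

Definition spike (p : R) : R :=
  if unit_frac (spike_index p).*2 == p then `|x (spike_index p)| else 0.

Lemma unit_frac_lt m n : (unit_frac m < unit_frac n) = (n < m)%N.
Proof. by rewrite ltf_pV2 ?posrE// ltr_nat. Qed.

Lemma unit_frac_inj : injective unit_frac.
Proof. by move=> m n /invr_inj/eqP; rewrite eqr_nat => /eqP[]. Qed.

Lemma unit_frac_in n : unit_frac n \in unit_itv R.
Proof.
by apply/mem_set; rewrite /unit_itv /= in_itv /= invr_ge0 ler0n invf_le1 ?ler1n.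
Qed.

Lemma spike_ge0 p : 0 <= spike p.
Proof. by rewrite /spike; case: ifP. Qed.

Lemma spike_even n : spike (unit_frac n.*2) = `|x n|.
Proof.
have -> : spike (unit_frac n.*2) = `|x (spike_index (unit_frac n.*2))|.
  rewrite /spike ifT//; apply/eqP; rewrite /spike_index.
  by case: xgetP => [m _ //|/(_ n)/(_ erefl)].
congr (`|x _|); rewrite /spike_index.
by case: xgetP => [m _ /unit_frac_inj/double_inj|/(_ n)/(_ erefl)].
Qed.

Lemma spike_odd n : spike (unit_frac n.*2.+1) = 0.
Proof.
rewrite /spike ifN//; apply/eqP => /unit_frac_inj/(congr1 odd).
by rewrite /= !odd_double.
Qed.

(** Distinct points meet distinct spikes, so the values met are a rearrangement of
    part of [x]. *)
Lemma spike_sum_le (a e : nat -> R) (D : pred nat) (M : R) :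
  (forall n, 0 <= a n) -> nonincreasing_seq a -> Mon x ->
  (forall N, \sum_(i < N) a i * `|x i| <= M) -> {in D &, injective e} ->
  forall N, \sum_(i < N | D i) a i * spike (e i) <= M.
Proof.
move=> a0 a_dec x_mon x_M e_inj N; apply: le_trans (x_M N).
pose P n := D n && (unit_frac (spike_index (e n)).*2 == e n).
apply: (@le_trans _ _ (\sum_(i < N | P i) a i * `|x (spike_index (e i))|)).
  rewrite [leLHS]big_mkcond [leRHS]big_mkcond; apply: ler_sum => i _ /=.
  by rewrite /P /spike; case: (D i) => //=; case: ifP => //; rewrite mulr0.
apply: (@ler_sum_rearrange _ a (fun n => `|x n|) P (fun i => spike_index (e i))) => //.
  by apply/nonincreasing_seqP.
move=> i j /andP[Di /eqP ei] /andP[Dj /eqP ej] ij.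
by apply: e_inj => //; rewrite -ei -ej ij.
Qed.

End spike.

(** The oscillation of the spike function of [x] over an interval is at most the sum of
    its values at the two ends. A point is the left end of at most one
    nondegenerate interval of a nonoverlapping family, and likewise for right
    ends, so the [a]-variation is at most twice the sum of [a n * |x n|]. For the
    [b]-variation, the intervals from [1 / (2 n + 2)] to [1 / (2 n + 1)] produce
    exactly the sum of [b n * |x n|]. *)
Lemma mFIN_of_BV (R : realType) (a b : nat -> R) :
  (forall n, 0 <= a n) -> (forall n, 0 <= b n) -> nonincreasing_seq a ->
  BV a `<=` BV b -> mFIN a `<=` mFIN b.
Proof.
move=> a0 b0 a_dec sub_ab x [x_mon /(hphi_ltyP _ a0)[M x_M]].
split=> //; apply/hphi_ltyP => //.
pose y (p : unit_itv R) := spike x (set_val p).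
have M_ge0 : 0 <= M by have := x_M 0%N; rewrite big_ord0.
have /sub_ab[K _ y_K] : BV a y.
  exists (M + M + 1) => [|s t st disj]; first by rewrite ltr_wpDl// addr_ge0.
  apply/nneseries_leP => [n|N]; first exact: mulr_ge0.
  pose D n := set_val (s n) < set_val (t n).
  have disjD i j (z : R) :
      set_val (s i) < z < set_val (t i) -> set_val (s j) < z < set_val (t j) -> i = j.
    move=> zi zj; apply: (disj i j I I); exists z.
    by split; rewrite interior_itv_bnd /= in_itv.
  have s_inj : {in D &, injective (set_val \o s)}.
    move=> i j Di Dj /= sij; have := Di; have := Dj; rewrite !unfold_in /D -sij => Dj' Di'.
    pose m := Num.min (set_val (t i)) (set_val (t j)).
    have sm : set_val (s i) < m by rewrite lt_min Di'.
    have [mi mj] : m <= set_val (t i) /\ m <= set_val (t j).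
      by rewrite !ge_min !lexx orbT.
    by apply: (disjD i j ((set_val (s i) + m) / 2)) => //;
      rewrite -?sij; apply/andP; split; lra.
  have t_inj : {in D &, injective (set_val \o t)}.
    move=> i j Di Dj /= tij; have := Di; have := Dj; rewrite !unfold_in /D -tij => Dj' Di'.
    pose m := Num.max (set_val (s i)) (set_val (s j)).
    have mt : m < set_val (t i) by rewrite gt_max Di'.
    have [mi mj] : set_val (s i) <= m /\ set_val (s j) <= m.
      by rewrite !le_max !lexx orbT.
    by apply: (disjD i j ((set_val (t i) + m) / 2)) => //;
      rewrite -?tij; apply/andP; split; lra.
  have Hs := spike_sum_le a0 a_dec x_mon x_M s_inj N.
  have Ht := spike_sum_le a0 a_dec x_mon x_M t_inj N.
  apply: (@le_trans _ _ (M + M)); last by rewrite lerDl.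
  apply: le_trans (lerD Hs Ht); rewrite -big_split [leRHS]big_mkcond /=.
  apply: ler_sum => i _; rewrite /y; case: ifPn => [_|nD].
    rewrite -mulrDr ler_wpM2l// (le_trans (ler_normB _ _))//.
    by rewrite !ger0_norm ?spike_ge0// addrC.
  have /eqP -> : set_val (t i) == set_val (s i) by rewrite eq_le st andbT leNgt.
  by rewrite subrr normr0 mulr0.
pose r n : unit_itv R := exist _ (unit_frac R n) (unit_frac_in R n).
have r_le n : set_val (r n.*2.+1) <= set_val (r n.*2) by rewrite ltW// unit_frac_lt.
have := y_K (fun n => r n.*2.+1) (fun n => r n.*2) r_le.
rewrite nneseries_leP => [le_K|n]; last exact: mulr_ge0.
exists K => N; apply: le_trans (le_K _ N).
  by apply: ler_sum => i _; rewrite /y /= spike_even spike_odd subr0 normr_id.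
have no_overlap i j : (i < j)%N ->
    [set` `[set_val (r i.*2.+1), set_val (r i.*2)]]° `&`
    [set` `[set_val (r j.*2.+1), set_val (r j.*2)]]° !=set0 -> False.
  move=> ij [z []]; rewrite !interior_itv_bnd /= !in_itv /= => /andP[iz _] /andP[_ zj].
  have : unit_frac R j.*2 < unit_frac R i.*2.+1.
    rewrite unit_frac_lt; lia.
  by move: (lt_trans iz zj) => /lt_trans/[apply]; rewrite ltxx.
move=> i j _ _ ij; have [/no_overlap|/no_overlap|//] := ltngtP i j.
  by move/(_ ij).
by rewrite setIC => /(_ ij).
Qed.

(** * From inclusion of sequence spaces to partial sums *)

(** If the quotients of partial sums are unbounded, choose [k j] at which the
    quotient exceeds [4 ^ j], and let [x] be the sum over [j] of the indicators of
    [{0, ..., k j - 1}] with coefficients [c j = 2^-j / A j], where [A j] is the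
    sum of the first [k j] terms of [a]. This sequence is nonincreasing, its
    [a]-norm is at most the sum of all [2^-j], and its [b]-norm is at least
    [2^j] for every [j]. *)
Lemma sum_le_of_mFIN (R : realType) (a b : nat -> R) :
  (forall n, 0 < a n) -> (forall n, 0 < b n) ->
  mFIN a `<=` mFIN b ->
  exists eta, forall k, \sum_(i < k) b i <= eta * \sum_(i < k) a i.
Proof.
move=> a_gt0 b_gt0 sub_ab; apply: contrapT => /forallNP no_eta.
have : forall j, exists k, 4 ^+ j * (\sum_(i < k) a i) < \sum_(i < k) b i.
  move=> j; have /existsNP[k] := no_eta (4 ^+ j).
  by move=> /negP; rewrite -ltNge; exists k.
move=> /choice[k k_gap].
pose A j := \sum_(i < k j) a i.
have A_ge j : a 0%N <= A j.
  rewrite /A; case: (k j) (k_gap j) => [|m _]; first by rewrite !big_ord0 mulr0 ltxx.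
  by rewrite big_ord_recl lerDl sumr_ge0// => i _; exact: ltW.
have A_gt0 j : 0 < A j by exact: lt_le_trans (A_ge j).
pose c j := 2^-1 ^+ j / A j.
have c_ge0 j : 0 <= c j by rewrite divr_ge0 ?exprn_ge0 ?ltW.
pose u i j := if (i < k j)%N then c j else 0.
have u_ge0 i j : 0 <= u i j by rewrite /u; case: ifP.
pose X i := (\sum_(0 <= j <oo) (u i j)%:E)%E.
have X_ge0 i : (0 <= X i)%E.
  by apply: nneseries_ge0 => j _ _; rewrite lee_fin.
have X_le i : (X i <= (2 / a 0%N)%:E)%E.
  apply/nneseries_leP => // J; apply: (@le_trans _ _ (\sum_(j < J) 2^-1 ^+ j / a 0%N)).
    apply: ler_sum => j _; rewrite /u; case: ifP => _.
      by rewrite ler_wpM2l ?exprn_ge0// lef_pV2 ?posrE.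
    by rewrite divr_ge0 ?exprn_ge0 ?ltW.
  by rewrite -mulr_suml ler_pM2r ?invr_gt0// sum_half_le.
have X_fin i : X i \is a fin_num.
  by rewrite ge0_fin_numE// (le_lt_trans (X_le i)) ?ltry.
pose x i := fine (X i).
have x_ge0 i : 0 <= x i by exact: fine_ge0.
have xE i : (x i)%:E = X i by rewrite fineK.
have x_ge i j : u i j <= x i.
  rewrite -lee_fin xE.
  apply: le_trans (nneseries_lim_ge (m := 0) j.+1 _).
    rewrite big_mkord sumEFin lee_fin big_ord_recr /= lerDr.
    exact: sumr_ge0.
  by move=> n _ _; rewrite lee_fin.
have x_mon : Mon x.
  move=> i; rewrite !ger0_norm// -lee_fin !xE.
  apply: lee_nneseries => j _; rewrite lee_fin// /u.
  by case: ltnP => [/ltnW ->//|_]; case: ifP.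
have [|_ /(hphi_ltyP _ (fun n => ltW (b_gt0 n)))[M b_M]] := sub_ab x.
  split=> //; apply/hphi_ltyP => [n|]; first exact: ltW.
  exists 2 => N; rewrite -lee_fin -sumEFin.
  under eq_bigr => i _.
    rewrite ger0_norm// EFinM xE /X -nneseriesZl; last by move=> ? _; rewrite lee_fin.
    under eq_eseriesr => j _ do rewrite -EFinM.
    over.
  rewrite -nneseries_sum; last by move=> *; rewrite lee_fin mulr_ge0// ltW.
  under eq_eseriesr => j _ do rewrite sumEFin.
  apply/nneseries_leP => [j|J]; first by apply: sumr_ge0 => i _; rewrite mulr_ge0// ltW.
  apply: le_trans (sum_half_le R J); apply: ler_sum => j _.
  have -> : 2^-1 ^+ j = c j * A j by rewrite divfK ?gt_eqF.
  rewrite mulr_sumr (big_ord_widen (N + k j) (fun i => c j * a i) (leq_addl N _)).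
  apply: (@le_trans _ _ (\sum_(i < N + k j) a i * u i j)).
    by apply: (@ler_sum_nat_mono _ (fun i => a i * u i j)) (leq_addr _ _) => i;
      rewrite mulr_ge0// ltW.
  rewrite [leRHS]big_mkcond; apply: ler_sum => i _ /=.
  by rewrite /u; case: ifP => _; rewrite ?mulr0// mulrC.
have {}b_M j : 2 ^+ j <= M.
  apply: le_trans (b_M (k j)).
  apply: (@le_trans _ _ (\sum_(i < k j) b i * c j)).
    have -> : 2 ^+ j = 4 ^+ j * A j * c j :> R.
      rewrite -mulrA (mulrC (A j)) divfK ?gt_eqF// -exprMn.
      by congr (_ ^+ _); lra.
    by rewrite -mulr_suml ler_wpM2r// ltW.
  apply: ler_sum => i _; rewrite ler_pM2l// ger0_norm//.
  by apply: le_trans (x_ge i j); rewrite /u ltn_ord.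
have := b_M (Num.bound `|M|); rewrite leNgt => /negP; apply.
apply: (le_lt_trans (ler_norm M)); apply: (lt_le_trans (archi_boundP _)) => //.
by rewrite -natrX ler_nat ltnW// ltn_expl.
Qed.

(** * The equivalence *)

Lemma sum_le_pos_bound (R : realType) (a b : nat -> R) :
  (forall n, 0 <= a n) ->
  (exists eta, forall n, \sum_(i < n) b i <= eta * \sum_(i < n) a i) ->
  exists2 eta, 0 < eta &
    forall n, \sum_(i < n) b i <= eta * \sum_(i < n) a i.
Proof.
move=> a0 [eta le_BA]; exists (`|eta| + 1) => [|n]; first by rewrite ltr_wpDl.
apply: (le_trans (le_BA n)); apply: ler_wpM2r; first exact: sumr_ge0.
by rewrite (le_trans (ler_norm _))// lerDl.
Qed.

Theorem theorem6p2 (R : realType) (a b : nat -> R) :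
  Waterman a -> Waterman b ->
  [<-> exists2 eta : R, 0 < eta & forall n : nat,
         (\sum_(i < n.+1) b i) / (\sum_(i < n.+1) a i) <= eta;
       Katetov_le (summable_ideal a) (summable_ideal b);
       mono_dominated b a;
       BV a `<=` BV b;
       mEXH a `<=` mEXH b;
       mFIN a `<=` mFIN b;
       mEXH a `<=` mFIN b].
Proof.
move=> [a_gt0 /nonincreasing_seqP a_dec _] [b_gt0 /nonincreasing_seqP b_dec _].
have a0 n : 0 <= a n := ltW (a_gt0 n).
have b0 n : 0 <= b n := ltW (b_gt0 n).
rewrite !mEXH_mFIN//; tfae => //.
- move=> [eta eta_gt0 /(sum_ratio_leP _ _ a_gt0)].
  exact: Katetov_of_sum_le.
- move=> [f f_Katetov].
  have [eta eta_gt0 le_BA] : exists2 eta, 0 < eta &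
      forall n, \sum_(i < n) b i <= eta * \sum_(i < n) a i.
    by apply: sum_le_pos_bound => //; exact: sum_le_of_Katetov f_Katetov.
  exact: mono_dominated_of_sum_le le_BA.
- exact: mono_dominated_BV.
- exact: mFIN_of_BV.
- move=> sub_ab.
  have [eta eta_gt0 le_BA] : exists2 eta, 0 < eta &
      forall n, \sum_(i < n) b i <= eta * \sum_(i < n) a i.
    by apply: sum_le_pos_bound => //; exact: sum_le_of_mFIN sub_ab.
  by exists eta => //; apply/sum_ratio_leP.
Qed.
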